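(* Let $(M,\alpha)$ be a strict contact manifold and let $f,g\in\mathcal{C}^\infty(M,\mathbb{R})$. Then $$[f,g]=X_f(g)-g\,R_\alpha(f),$$ where $[\cdot,\cdot]$ is the Jacobi bracket.
   Context: A strict contact manifold $(M,\alpha)$ is a $(2n+1)$-dimensional smooth manifold $M$ with a smooth 1-form $\alpha$ such that $\alpha\wedge(d\alpha)^n$ is nowhere zero. The Reeb vector field $R_\alpha$ is the unique vector field with $\iota_{R_\alpha}d\alpha=0$ and $\alpha(R_\alpha)=1$. For a smooth function $H$ on $M$, the contact Hamiltonian vector field $X_H$ is the unique vector field with $\alpha(X_H)=H$ and $\iota_{X_H}d\alpha=dH(R_\alpha)\alpha-dH$. The Jacobi bracket is $[f,g]=\alpha([X_f,X_g])$, with $[X_f,X_g]$ the Lie bracket of vector fields. For a vector field $X$ and a function $h$, $X(h)=dh(X)$. *)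

(* Defs.v *)
From HB Require Import structures.
From mathcomp Require Import all_boot all_order all_algebra.
From mathcomp Require Import perm ring.
From mathcomp Require Import all_classical reals topology normedtype landau derive realfun.

Set Implicit Arguments.
Unset Strict Implicit.
Unset Printing Implicit Defensive.
Import Order.TTheory GRing.Theory Num.Theory.
Import numFieldNormedType.Exports.
Local Open Scope classical_set_scope.
Local Open Scope ring_scope.

Section Calculus.
Context {R : realType}.

(* F is C^infinity on the open set U iff all its iterated directional
   derivatives, of every order, are (Frechet) differentiable on U. *)
Fixpoint diff_upto {V W : normedModType R} (k : nat) (U : set V) (F : V -> W)
    : Prop :=
  if k is l.+1 then
    (forall x, U x -> differentiable F x) /\
    (forall v, diff_upto l U (fun x => 'D_v F x))
  else True.

Definition smooth_on {V W : normedModType R} (U : set V) (F : V -> W) : Prop :=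
  forall k, diff_upto k U F.

Section Generic.
Context {V W : normedModType R}.
Implicit Types (U : set V) (F G : V -> W).

Lemma open_near_eq (T : Type) U (F G : V -> T) x :
  open U -> U x -> (forall y, U y -> F y = G y) -> {near x, F =1 G}.
Proof. by move=> oU Ux FG; apply: filterS (open_nbhs_nbhs (conj oU Ux)). Qed.

Lemma near_eq_differentiable F G x :
  {near x, F =1 G} -> differentiable F x -> differentiable G x.
Proof.
move=> FG /diff_locallyP[cF dF].
have FGx : F x = G x := nbhs_singleton FG.
have eG : G \o shift x = cst (G x) + 'd F x +o_ 0 id.
  apply/eqaddoP => e e0.
  move/eqaddoP : dF => /(_ e e0) dF.
  have FG0 : \forall y \near (0 : V), F (y + x) = G (y + x).
    have := near_shift (0 : V) x (fun y => F y = G y).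
    by rewrite subr0 /= => <-.
  apply: filterS2 dF FG0 => y /= + Fy.
  by rewrite !fctE /= -Fy -FGx.
by apply/diff_locallyP; rewrite (diff_unique cF eG).
Qed.

Lemma diff_upto_eq k U F G : open U -> (forall x, U x -> F x = G x) ->
  diff_upto k U F -> diff_upto k U G.
Proof.
elim: k F G => //= k IH F G oU FG [dF DF]; split=> [x Ux|v].
  exact: near_eq_differentiable (open_near_eq oU Ux FG) (dF x Ux).
apply: IH (DF v) => // x Ux; apply: near_eq_derive.
exact: open_near_eq oU Ux FG.
Qed.

Lemma diff_upto_le k U F : diff_upto k.+1 U F -> diff_upto k U F.
Proof.
elim: k F => //= k IH F [dF DF]; split=> // v; apply: IH; exact: DF.
Qed.

Lemma diff_upto_sub k U U' F : U' `<=` U -> diff_upto k U F -> diff_upto k U' F.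
Proof.
move=> UU'; elim: k F => //= k IH F [dF DF]; split=> [x /UU'/dF//|v].
exact: IH.
Qed.

Lemma diff_uptoB k U F G : open U ->
  diff_upto k U F -> diff_upto k U G -> diff_upto k U (fun x => F x - G x).
Proof.
move=> oU; elim: k F G => //= k IH F G [dF DF] [dG DG]; split=> [x Ux|v].
  by apply: differentiableB; [exact: dF|exact: dG].
apply: diff_upto_eq (IH _ _ (DF v) (DG v)) => // x Ux.
by rewrite -deriveB//; apply: diff_derivable; (exact: dF || exact: dG).
Qed.

Lemma smoothB U F G : open U ->
  smooth_on U F -> smooth_on U G -> smooth_on U (fun x => F x - G x).
Proof. by move=> oU sF sG k; exact: diff_uptoB. Qed.

Lemma diff_uptoD k U F G : open U ->
  diff_upto k U F -> diff_upto k U G -> diff_upto k U (fun x => F x + G x).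
Proof.
move=> oU; elim: k F G => //= k IH F G [dF DF] [dG DG]; split=> [x Ux|v].
  by apply: differentiableD; [exact: dF|exact: dG].
apply: diff_upto_eq (IH _ _ (DF v) (DG v)) => // x Ux.
by rewrite -deriveD//; apply: diff_derivable; (exact: dF || exact: dG).
Qed.

Lemma diff_upto0 k U : open U -> diff_upto k U (fun=> 0 : W).
Proof.
move=> oU; elim: k => //= k IH; split=> [x Ux|v].
  exact: (@differentiable_cst _ _ _ (0 : W) x).
by apply: diff_upto_eq IH => // x _; rewrite derive_cst.
Qed.

Lemma diff_upto_sum k U (I : Type) (r : seq I) (F : I -> V -> W) : open U ->
  (forall i, diff_upto k U (F i)) -> diff_upto k U (fun x => \sum_(i <- r) F i x).
Proof.
move=> oU dF; elim: r => [|i r IH].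
  by apply: diff_upto_eq (diff_upto0 k oU) => // x _; rewrite big_nil.
apply: diff_upto_eq (diff_uptoD oU (dF i) IH) => // x _.
by rewrite big_cons.
Qed.

Lemma derive_smooth U F v : smooth_on U F -> smooth_on U (fun x => 'D_v F x).
Proof. by move=> sF k; have [_] := sF k.+1; apply. Qed.

Lemma smooth_diff U F x : smooth_on U F -> U x -> differentiable F x.
Proof. by move=> sF; have [+ _] := sF 1%N; apply. Qed.

End Generic.

Section Real.
Context {V : normedModType R}.
Implicit Types (U : set V) (F G : V -> R).

Lemma diff_uptoM k U F G : open U ->
  diff_upto k U F -> diff_upto k U G -> diff_upto k U (fun x => F x * G x).
Proof.
move=> oU; elim: k F G => //= k IH F G [dF DF] [dG DG]; split=> [x Ux|v].
  by apply: differentiableM; [exact: dF|exact: dG].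
have lF : diff_upto k U F by apply: diff_upto_le.
have lG : diff_upto k U G by apply: diff_upto_le.
apply: diff_upto_eq (diff_uptoD oU (IH _ _ lF (DG v)) (IH _ _ lG (DF v))) => //.
move=> x Ux.
by rewrite deriveM//; apply: diff_derivable; (exact: dF || exact: dG).
Qed.

End Real.

Section Matrix.
Context {V : normedModType R} {m n : nat}.
Implicit Types (U : set V) (F G : V -> 'M[R]_(m, n)).

Lemma differentiable_mxP F x :
  (forall i j, differentiable (fun y => F y i j) x) <-> differentiable F x.
Proof.
split=> [dF|dF i j]; last first.
  apply: (@differentiable_comp _ _ _ _ F (fun N : 'M[R]_(m, n) => N i j)) => //.
  exact: differentiable_coord.
have -> : F = \sum_i \sum_j (fun y => F y i j *: delta_mx i j).
  apply/funext => y; rewrite fct_sumE [LHS]matrix_sum_delta.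
  by apply: eq_bigr => i _; rewrite fct_sumE.
apply: differentiable_sum => i; apply: differentiable_sum => j.
exact: differentiableZl.
Qed.

Lemma derive_coord F x v i j : differentiable F x ->
  'D_v (fun y => F y i j) x = 'D_v F x i j.
Proof.
by move=> dF; rewrite derive_mx ?mxE//; apply: diff_derivable.
Qed.

Lemma diff_upto_mxP k U F : open U ->
  (forall i j, diff_upto k U (fun y => F y i j)) <-> diff_upto k U F.
Proof.
move=> oU; elim: k F => //= k IH F; split=> [dF|[dF DF] i j].
  have dF1 x : U x -> differentiable F x.
    by move=> Ux; apply/differentiable_mxP => i j; case: (dF i j) => + _; apply.
  split=> // v; apply/IH => i j; case: (dF i j) => _ /(_ v).
  by apply: diff_upto_eq => // x Ux; rewrite derive_coord//; exact: dF1.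
split=> [x Ux|v]; first by apply: (differentiable_mxP F x).2; exact: dF.
have /IH/(_ i j) := DF v.
by apply: diff_upto_eq => // x Ux; rewrite derive_coord//; exact: dF.
Qed.

End Matrix.

Section Chain.
Context {V W X : normedModType R}.

Lemma derive_chain (T : V -> W) (F : W -> X) x v :
  differentiable T x -> differentiable F (T x) ->
  'D_v (fun y => F (T y)) x = 'D_('D_v T x) F (T x).
Proof.
move=> dT dF; rewrite deriveE; last exact: differentiable_comp.
by rewrite diff_comp// !deriveE.
Qed.

Lemma derive_sum_dir (F : V -> W) x (I : Type) (r : seq I) (a : I -> R)
    (v : I -> V) : differentiable F x ->
  'D_(\sum_(i <- r) a i *: v i) F x = \sum_(i <- r) a i *: 'D_(v i) F x.
Proof.
move=> dF; rewrite deriveE// linear_sum; apply: eq_bigr => i _.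
by rewrite linearZ deriveE.
Qed.

Lemma deriveB_dir (F : V -> W) x u v : differentiable F x ->
  'D_(u - v) F x = 'D_u F x - 'D_v F x.
Proof. by move=> dF; rewrite !deriveE// linearB. Qed.

End Chain.


Section Clairaut.
Context {V : normedModType R}.
Implicit Types (U : set V) (F G : V -> R).

Lemma is_derive_line F p v (a : R) : differentiable F (p + a *: v) ->
  is_derive a 1 (fun s : R => F (p + s *: v)) ('D_v F (p + a *: v)).
Proof.
move=> dF.
have dT : differentiable (fun s : R => p + s *: v) a.
  apply: differentiableD; first exact: (@differentiable_cst _ _ _ p a).
  exact: differentiableZl.
have DT : 'D_1 (fun s : R => p + s *: v) a = v.
  rewrite deriveD//; first last.
    by apply: diff_derivable; exact: differentiableZl.
  rewrite derive_cst add0r deriveE; last exact: differentiableZl.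
  by rewrite diffZl//= diff_val scale1r.
apply: DeriveDef.
  apply: diff_derivable.
  by apply: (@differentiable_comp _ _ _ _ (fun s : R => p + s *: v) F).
by rewrite (derive_chain _ dT dF) DT.
Qed.

Lemma MVT_line (G : R -> R) (dG : R -> R) (t : R) : 0 < t ->
  (forall a, 0 <= a <= t -> is_derive a 1 G (dG a)) ->
  exists2 a, 0 <= a <= t & G t - G 0 = t * dG a.
Proof.
move=> t0 GdG; have [||a] := @MVT _ G dG 0 t t0.
- move=> a; rewrite in_itv /= => /andP[a0 at_]; apply: GdG.
  by rewrite !ltW.
- apply: derivable_within_continuous => a; rewrite in_itv /= => /GdG[]//.
- rewrite in_itv /= => /andP[a0 at_] ->; exists a; first by rewrite !ltW.
  by rewrite subr0 mulrC.
Qed.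

Lemma second_difference U F x v w (t : R) : 0 < t -> smooth_on U F ->
  (forall a b : R, 0 <= a <= t -> 0 <= b <= t -> U (x + (a *: v + b *: w))) ->
  exists a b : R, [/\ 0 <= a <= t, 0 <= b <= t &
    (F (x + (t *: v + t *: w)) - F (x + t *: v))
      - (F (x + t *: w) - F x) =
    t * (t * 'D_w (fun z => 'D_v F z) (x + (a *: v + b *: w)))].
Proof.
move=> t0 sF Ut.
have t01 : 0 <= t <= t by rewrite lexx ltW.
have z01 : 0 <= (0 : R) <= t by rewrite lexx ltW.
pose G a := F ((x + t *: w) + a *: v) - F (x + a *: v).
have [a ha Ea] : exists2 a, 0 <= a <= t & G t - G 0 = t *
    ('D_v F ((x + t *: w) + a *: v) - 'D_v F (x + a *: v)).
  apply: (@MVT_line G (fun a => 'D_v F ((x + t *: w) + a *: v) -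
      'D_v F (x + a *: v)) t t0) => a ha.
  have d1 := Ut a t ha t01; have d2 := Ut a 0 ha z01.
  rewrite scale0r addr0 in d2; rewrite [_ *: _ + _]addrC addrA in d1.
  have /is_derive_line D1 := smooth_diff sF d1.
  have /is_derive_line D2 := smooth_diff sF d2.
  exact: is_deriveB.
pose H b := 'D_v F ((x + a *: v) + b *: w).
have [b hb Eb] : exists2 b, 0 <= b <= t & H t - H 0 =
    t * 'D_w (fun z => 'D_v F z) ((x + a *: v) + b *: w).
  apply: (@MVT_line H (fun b => 'D_w (fun z => 'D_v F z)
     ((x + a *: v) + b *: w)) t t0) => b hb.
  have d1 := Ut a b ha hb; rewrite addrA in d1.
  exact: (is_derive_line (smooth_diff (derive_smooth v sF) d1)).
exists a, b; split=> //.
rewrite (addrA x (a *: v)) -Eb /H scale0r addr0 (addrAC x) -Ea /G.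
by rewrite scale0r !addr0 (addrA x) (addrAC x (t *: v)) !opprB !addrA.

Qed.

Lemma dist_lt2 (A B C C' e : R) : C' = C -> `|B - C'| < e -> `|A - C| < e ->
  `|A - B| < e + e.
Proof.
move=> -> ltBC ltAC; have -> : A - B = (A - C) + (C - B) by rewrite addrA subrK.
by rewrite (le_lt_trans (ler_normD _ _))// ltrD// distrC.
Qed.

Lemma Clairaut U F x v w :
  open U -> U x -> smooth_on U F ->
  'D_v (fun y => 'D_w F y) x = 'D_w (fun y => 'D_v F y) x.
Proof.
move=> oU Ux sF.
pose G v w y := 'D_w (fun z => 'D_v F z) y.
rewrite -/(G w v x) -/(G v w x).
have sG v' w' : smooth_on U (G v' w') by do 2!apply: derive_smooth.
apply/eqP; apply: contraT => GG.
have e0 : 0 < `|G w v x - G v w x| / 2.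
  by rewrite divr_gt0// normr_gt0 subr_eq0.
set e := _ / 2 in e0.
have near_G v' w' : \forall y \near x, `|G v' w' x - G v' w' y| < e.
  have /differentiable_continuous := smooth_diff (sG v' w') Ux.
  by move=> /cvgrPdist_lt/(_ _ e0).
have : \forall y \near x, [/\ U y, `|G w v x - G w v y| < e &
    `|G v w x - G v w y| < e].
  have nU : nbhs x U by exact: open_nbhs_nbhs.
  by apply: filterS3 nU (near_G w v) (near_G v w) => y.
move=> /nbhs_normP[r /= r0 Pr].
pose t := r / 2 / (`|v| + `|w| + 1).
have D0 : 0 < `|v| + `|w| + 1 by rewrite ltr_wpDl// addr_ge0.
have t0 : 0 < t by rewrite !divr_gt0.
have tr a b : 0 <= a <= t -> 0 <= b <= t -> `|a *: v + b *: w| < r.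
  move=> /andP[a0 at'] /andP[b0 bt].
  rewrite (le_lt_trans (ler_normD _ _))// !normrZ !ger0_norm//.
  apply: (@le_lt_trans _ _ (t * (`|v| + `|w| + 1))).
    by rewrite mulrDr mulr1 mulrDr ler_wpDr ?(ltW t0)// lerD// ler_wpM2r.
  by rewrite divfK ?gt_eqF// ltr_pdivrMr// ltr_pMr// ltr1n.
have PA a b : 0 <= a <= t -> 0 <= b <= t -> let y := x + (a *: v + b *: w) in
    [/\ U y, `|G w v x - G w v y| < e & `|G v w x - G v w y| < e].
  by move=> ha hb /=; apply: Pr; rewrite /= opprD addNKr normrN tr.
have PA' b a : 0 <= b <= t -> 0 <= a <= t -> let y := x + (b *: w + a *: v) in
    [/\ U y, `|G w v x - G w v y| < e & `|G v w x - G v w y| < e].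
  by move=> hb ha; rewrite [_ *: _ + _]addrC; exact: PA.
have [a [b [ha hb E1]]] := second_difference t0 sF
  (fun a b ha hb => (let: And3 P _ _ := PA a b ha hb in P)).
have [b' [a' [hb' ha' E2]]] := second_difference t0 sF
  (fun b a hb ha => (let: And3 P _ _ := PA' b a hb ha in P)).
have E : G v w (x + (a *: v + b *: w)) = G w v (x + (b' *: w + a' *: v)).
  have tN0 : t != 0 by rewrite gt_eqF.
  apply/(mulfI tN0)/(mulfI tN0).
  apply: etrans (esym E1) _; apply: etrans _ E2; rewrite (addrC (t *: w)).
  set p1 := F _; set p2 := F _; set p3 := F _; set p4 := F _.
  by rewrite !opprB !addrA addrAC [RHS]addrAC (addrAC p1).
have [_ _ H1] := PA _ _ ha hb; have [_ H2 _] := PA' _ _ hb' ha'.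
have := dist_lt2 E H1 H2.
by rewrite /e -splitr ltxx.
Qed.

End Clairaut.

End Calculus.

Section Manifold.
Context {R : realType}.

Record chart (M : topologicalType) (m : nat) := Chart {
  chart_dom : set M;
  chart_img : set 'rV[R]_m;
  chart_fwd : M -> 'rV[R]_m;
  chart_bwd : 'rV[R]_m -> M;
  chart_dom_open : open chart_dom;
  chart_img_open : open chart_img;
  chart_fwd_img : forall p, chart_dom p -> chart_img (chart_fwd p);
  chart_bwd_dom : forall x, chart_img x -> chart_dom (chart_bwd x);
  chart_fwdK : forall p, chart_dom p -> chart_bwd (chart_fwd p) = p;
  chart_bwdK : forall x, chart_img x -> chart_fwd (chart_bwd x) = x;
  chart_fwd_cont : forall p, chart_dom p -> {for p, continuous chart_fwd};
  chart_bwd_cont : forall x, chart_img x -> {for x, continuous chart_bwd} }.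

Definition overlap (M : topologicalType) (m : nat) (c c' : chart M m) :
  set 'rV[R]_m :=
  [set x | chart_img c x /\ chart_dom c' (chart_bwd c x)].

Definition transition (M : topologicalType) (m : nat) (c c' : chart M m) :
  'rV[R]_m -> 'rV[R]_m := fun x => chart_fwd c' (chart_bwd c x).

Lemma overlap_open (M : topologicalType) (m : nat) (c c' : chart M m) :
  open (overlap c c').
Proof.
rewrite openE => x [cx c'x]; rewrite /interior.
have cim : nbhs x (chart_img c).
  by apply: open_nbhs_nbhs; split=> //; exact: chart_img_open.
have cdom : nbhs x (chart_bwd c @^-1` chart_dom c').
  apply: (chart_bwd_cont cx).
  by apply: open_nbhs_nbhs; split=> //; exact: chart_dom_open.
by apply: filterS2 cim cdom.
Qed.

End Manifold.
Arguments chart R M m : clear implicits.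

(* The atlas need not be maximal: everything below only refers to its charts. *)
Record smooth_manifold (R : realType) (m : nat) := SmoothManifold {
  carrier :> topologicalType;
  carrier_hausdorff : hausdorff_space carrier;
  carrier_second_countable : @second_countable carrier;
  chart_index : Type;
  atlas : chart_index -> chart R carrier m;
  atlas_cover : forall p : carrier, exists i, chart_dom (atlas i) p;
  atlas_smooth : forall i j,
    smooth_on (overlap (atlas i) (atlas j)) (transition (atlas i) (atlas j)) }.

Section Fields.
Context {R : realType} {m : nat} (M : smooth_manifold R m).
Local Notation img i := (chart_img (atlas (s := M) i)).
Local Notation dom i := (chart_dom (atlas (s := M) i)).
Local Notation bwd i := (chart_bwd (atlas (s := M) i)).
Local Notation fwd i := (chart_fwd (atlas (s := M) i)).
Local Notation ovl i j := (overlap (atlas (s := M) i) (atlas (s := M) j)).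
Local Notation tau i j := (transition (atlas (s := M) i) (atlas (s := M) j)).

Record smooth_fun := SmoothFun {
  sf_fun :> M -> R;
  sf_smooth : forall i, smooth_on (img i) (fun x => sf_fun (bwd i x)) }.

(* Tensor fields are given by their components in every chart of the atlas,
   subject to the transformation rule on overlaps; values outside the image of
   a chart are irrelevant. Vectors are rows, so that 'J (which acts on rows)
   pushes them forward, and covectors are columns. *)
Record vector_field := VectorField {
  vf_comp : chart_index M -> 'rV[R]_m -> 'rV[R]_m;
  vf_smooth : forall i, smooth_on (img i) (vf_comp i);
  vf_change : forall i j x, ovl i j x ->
    vf_comp j (tau i j x) = vf_comp i x *m 'J (tau i j) x }.

Record one_form := OneForm {
  of_comp : chart_index M -> 'rV[R]_m -> 'cV[R]_m;
  of_smooth : forall i, smooth_on (img i) (of_comp i);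
  of_change : forall i j x, ovl i j x ->
    of_comp i x = 'J (tau i j) x *m of_comp j (tau i j x) }.

(* The entry (k, l) is the value on the k-th and l-th coordinate vectors. *)
Record two_form := TwoForm {
  tf_comp : chart_index M -> 'rV[R]_m -> 'M[R]_m;
  tf_alt : forall i x, img i x -> (tf_comp i x)^T = - tf_comp i x;
  tf_smooth : forall i, smooth_on (img i) (tf_comp i);
  tf_change : forall i j x, ovl i j x ->
    tf_comp i x =
      'J (tau i j) x *m tf_comp j (tau i j x) *m ('J (tau i j) x)^T }.

Lemma smooth_mxP (V : normedModType R) a b (U : set V) (F : V -> 'M[R]_(a, b)) :
  open U -> (forall i j, smooth_on U (fun y => F y i j)) <-> smooth_on U F.
Proof.
move=> oU; split=> [sF k|sF i j k].
  by apply: (diff_upto_mxP k F oU).1 => i j; exact: sF.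
exact: (diff_upto_mxP k F oU).2 (sF k) i j.
Qed.

Lemma smooth_mulmx (V : normedModType R) a b c (U : set V)
    (F : V -> 'M[R]_(a, b)) (G : V -> 'M[R]_(b, c)) : open U ->
  smooth_on U F -> smooth_on U G -> smooth_on U (fun x => F x *m G x).
Proof.
move=> oU /(smooth_mxP _ oU) sF /(smooth_mxP _ oU) sG.
apply/smooth_mxP => // i j k.
have H : diff_upto k U (fun x => \sum_l F x i l * G x l j : R).
  by apply: diff_upto_sum => // l; exact: diff_uptoM oU (sF i l k) (sG l j k).
by apply: diff_upto_eq H => // x _; rewrite mxE.
Qed.

Lemma smooth_eq (V W : normedModType R) (U : set V) (F G : V -> W) : open U ->
  (forall x, U x -> F x = G x) -> smooth_on U F -> smooth_on U G.
Proof. by move=> oU FG sF k; apply: diff_upto_eq (sF k). Qed.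

Lemma smooth_sub (V W : normedModType R) (U U' : set V) (F : V -> W) :
  U' `<=` U -> smooth_on U F -> smooth_on U' F.
Proof. by move=> UU' sF k; apply: diff_upto_sub (sF k). Qed.

Lemma img_open i : open (img i). Proof. exact: chart_img_open. Qed.

Lemma ovl_tau i j x : ovl i j x -> img j (tau i j x).
Proof. by case=> _; exact: chart_fwd_img. Qed.

Lemma ovl_bwd i j x : ovl i j x -> bwd j (tau i j x) = bwd i x.
Proof. by case=> _; exact: chart_fwdK. Qed.

Lemma tau_diff i j x : ovl i j x -> differentiable (tau i j) x.
Proof. by apply: smooth_diff; exact: atlas_smooth. Qed.

(* The value below at p is computed in an arbitrary chart around p;
   pairing_chart shows that it does not depend on the chart. *)
Definition chart_at (p : M) : chart_index M := projT1 (cid (atlas_cover p)).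

Lemma chart_atP p : dom (chart_at p) p.
Proof. exact: projT2 (cid (atlas_cover p)). Qed.

Definition pairing_fun (alpha : one_form) (X : vector_field) (p : M) : R :=
  let x := fwd (chart_at p) p in
  (vf_comp X (chart_at p) x *m of_comp alpha (chart_at p) x) 0 0.

Lemma pairing_chart alpha X i x : img i x ->
  pairing_fun alpha X (bwd i x) = (vf_comp X i x *m of_comp alpha i x) 0 0.
Proof.
move=> ix; have Oij : ovl i (chart_at (bwd i x)) x by split=> //; exact: chart_atP.
rewrite /pairing_fun -/(transition (atlas i) _ x) (vf_change X Oij).
by rewrite [in RHS](of_change alpha Oij) mulmxA.
Qed.

Fact pairing_smooth alpha X i :
  smooth_on (img i) (fun x => pairing_fun alpha X (bwd i x)).
Proof.
have oi := @img_open i.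
have := smooth_mulmx oi (vf_smooth X i) (of_smooth alpha i).
move=> /(smooth_mxP _ oi)/(_ 0 0); apply: smooth_eq => // x ix.
by rewrite pairing_chart.
Qed.

Definition pairing alpha X : smooth_fun := SmoothFun (pairing_smooth alpha X).

Definition contraction_comp (X : vector_field) (w : two_form) i x : 'cV[R]_m :=
  (vf_comp X i x *m tf_comp w i x)^T.

Fact contraction_smooth X w i : smooth_on (img i) (contraction_comp X w i).
Proof.
have oi := @img_open i.
have /(smooth_mxP _ oi) sXw := smooth_mulmx oi (vf_smooth X i) (tf_smooth w i).
apply/smooth_mxP => // k l; apply: smooth_eq (sXw l k) => // x _.
by rewrite [RHS]mxE.
Qed.

Fact contraction_change X w i j x : ovl i j x ->
  contraction_comp X w i x =
    'J (tau i j) x *m contraction_comp X w j (tau i j x).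
Proof.
move=> Oij; rewrite /contraction_comp (tf_change w Oij) (vf_change X Oij).
by rewrite !trmx_mul trmxK !mulmxA.
Qed.

Definition contraction X w : one_form :=
  OneForm (contraction_smooth X w) (@contraction_change X w).

Definition differential_comp (f : smooth_fun) i x : 'cV[R]_m :=
  \col_k 'D_(delta_mx 0 k) (fun y => f (bwd i y)) x.

Fact differential_smooth f i : smooth_on (img i) (differential_comp f i).
Proof.
have oi := @img_open i; apply/smooth_mxP => // k l.
apply: smooth_eq (derive_smooth (delta_mx 0 k) (sf_smooth f i)) => // x _.
by rewrite mxE.
Qed.

Lemma derive_rV (W : normedModType R) (F : 'rV[R]_m -> W) x (v : 'rV[R]_m) :
  differentiable F x -> 'D_v F x = \sum_k v 0 k *: 'D_(delta_mx 0 k) F x.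
Proof. by move=> dF; rewrite -derive_sum_dir// {1}(row_sum_delta v). Qed.

Lemma J_entry a b (F : 'rV[R]_a -> 'rV[R]_b) x k l : differentiable F x ->
  'J F x k l = 'D_(delta_mx 0 k) F x 0 l.
Proof. by move=> dF; rewrite deriveEjacobian// -rowE [RHS]mxE. Qed.

Lemma tau_near i j (T : Type) (F G : 'rV[R]_m -> T) x : ovl i j x ->
  (forall y, ovl i j y -> F y = G y) -> {near x, F =1 G}.
Proof. by move=> Oij; apply: open_near_eq => //; exact: overlap_open. Qed.

Lemma derive2C (U : set 'rV[R]_m) (F : 'rV[R]_m -> 'rV[R]_m) x v w a b :
  open U -> smooth_on U F -> U x ->
  'D_v (fun y => 'D_w F y) x a b = 'D_w (fun y => 'D_v F y) x a b.
Proof.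
move=> oU sF Ux.
have sFab := (smooth_mxP F oU).2 sF a b.
have E u u' : 'D_u (fun y => 'D_u' F y) x a b =
    'D_u (fun y => 'D_u' (fun z => F z a b) y) x.
  rewrite -derive_coord; last exact: smooth_diff (derive_smooth _ sF) Ux.
  apply: near_eq_derive; apply: (open_near_eq oU Ux) => y Uy.
  by rewrite derive_coord//; exact: smooth_diff sF Uy.
apply: etrans (E v w) _; apply: etrans _ (esym (E w v)).
exact: (Clairaut v w oU Ux sFab).
Qed.

Fact differential_change f i j x : ovl i j x ->
  differential_comp f i x =
    'J (tau i j) x *m differential_comp f j (tau i j x).
Proof.
move=> Oij; apply/colP => k; rewrite !mxE.
have dt := tau_diff Oij.
have df := smooth_diff (sf_smooth f j) (ovl_tau Oij).
rewrite (@near_eq_derive _ _ _ _ (fun y => f (bwd j (tau i j y)))); last first.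
  by apply: (tau_near Oij) => y /ovl_bwd ->.
rewrite (derive_chain _ dt df) derive_rV//; apply: eq_bigr => l _.
by rewrite J_entry// mxE.
Qed.

Definition differential f : one_form :=
  OneForm (differential_smooth f) (@differential_change f).

(* d alpha (d_k, d_l) = d_k alpha_l - d_l alpha_k, that is
   d alpha (X, Y) = X (alpha Y) - Y (alpha X) - alpha [X, Y], without a factor 1/2. *)
Definition ext_deriv_comp (alpha : one_form) i x : 'M[R]_m :=
  \matrix_(k, l) ('D_(delta_mx 0 k) (of_comp alpha i) x l 0
                  - 'D_(delta_mx 0 l) (of_comp alpha i) x k 0).

Fact ext_deriv_alt alpha i x : img i x ->
  (ext_deriv_comp alpha i x)^T = - ext_deriv_comp alpha i x.
Proof. by move=> _; apply/matrixP => k l; rewrite !mxE opprB. Qed.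

Fact ext_deriv_smooth alpha i : smooth_on (img i) (ext_deriv_comp alpha i).
Proof.
have oi := @img_open i; apply/smooth_mxP => // k l.
have sa h k' : smooth_on (img i)
    (fun x => 'D_(delta_mx 0 h) (of_comp alpha i) x k' 0).
  have /(smooth_mxP _ oi)/(_ k' 0) :=
    derive_smooth (delta_mx 0 h) (of_smooth alpha i).
  exact.
apply: smooth_eq (smoothB oi (sa k l) (sa l k)) => // x _.
by rewrite mxE.
Qed.

Fact ext_deriv_change alpha i j x : ovl i j x ->
  ext_deriv_comp alpha i x = 'J (tau i j) x *m
    ext_deriv_comp alpha j (tau i j x) *m ('J (tau i j) x)^T.
Proof.
move=> Oij; have dt := tau_diff Oij.
have oO : open (ovl i j) by exact: overlap_open.
have da := smooth_diff (of_smooth alpha j) (ovl_tau Oij).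
set J := 'J _ _.
pose A q p := 'D_(delta_mx 0 q) (of_comp alpha j) (tau i j x) p 0.
pose S k l := \sum_p 'D_(delta_mx 0 k) (fun y =>
  'D_(delta_mx 0 l) (tau i j) y) x 0 p * of_comp alpha j (tau i j x) p 0.
have Dcomp k l : 'D_(delta_mx 0 k) (of_comp alpha i) x l 0 =
    S k l + \sum_p \sum_q J k q * A q p * J l p.
  have dDt : differentiable (fun y => 'D_(delta_mx 0 l) (tau i j) y) x.
    exact: smooth_diff (derive_smooth _ (atlas_smooth _ _)) Oij.
  have dA : differentiable (fun y => of_comp alpha j (tau i j y)) x.
    exact: (@differentiable_comp _ _ _ _ (tau i j)).
  rewrite -derive_coord; last first.
    by apply: smooth_diff (of_smooth alpha i) _; case: Oij.
  rewrite (@near_eq_derive _ _ _ _ (\sum_p (fun y =>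
      'D_(delta_mx 0 l) (tau i j) y 0 p * of_comp alpha j (tau i j y) p 0)));
      last first.
    apply: (tau_near Oij) => y Oy; rewrite (of_change alpha Oy) mxE fct_sumE.
    by apply: eq_bigr => p _; rewrite J_entry//; exact: tau_diff.
  have dDtp p := (differentiable_mxP _ _).2 dDt 0 p.
  have dAp p := (differentiable_mxP _ _).2 dA p 0.
  rewrite derive_sum => [|p]; last first.
    by apply: diff_derivable; exact: differentiableM.
  rewrite -big_split; apply: eq_bigr => p _ /=.
  rewrite deriveM; [|exact: diff_derivable..].
  rewrite [RHS]addrC; congr (_ + _); last first.
    by rewrite derive_coord//; exact: mulrC.
  rewrite derive_coord// (derive_chain _ dt da) (derive_rV _ da) summxE.
  apply: etrans (mulr_sumr _ _ _ _) _.
  apply: eq_bigr => q _; rewrite mxE; apply: etrans (mulrC _ _) _.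
  by congr (_ * _ * _); apply/esym/J_entry.
have SC k l : S k l = S l k.
  rewrite /S; apply: eq_bigr => p _; apply: (congr1 (fun z => z * _)).
  exact: (derive2C (delta_mx 0 k) (delta_mx 0 l) 0 p oO (atlas_smooth i j) Oij).
clearbody J; apply/matrixP => k l; rewrite [LHS]mxE.
apply: etrans (congr2 (fun a b => a - b) (Dcomp k l) (Dcomp l k)) _.
rewrite /= (SC k l).
rewrite opprD addrACA subrr add0r [RHS]mxE [X in _ - X]exchange_big -sumrB; apply: eq_bigr => p _.
rewrite !mxE mulr_suml -sumrB; apply: eq_bigr => q _.
rewrite mxE mulrBr mulrBl; congr (_ - _).
by rewrite mulrAC [RHS]mulrAC (mulrC (J l p)).
Qed.

Definition ext_deriv alpha : two_form :=
  TwoForm (@ext_deriv_alt alpha) (ext_deriv_smooth alpha)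
    (@ext_deriv_change alpha).

(* [X, Y]^l = X^k d_k Y^l - Y^k d_k X^l *)
Definition lie_bracket_comp (X Y : vector_field) i x : 'rV[R]_m :=
  'D_(vf_comp X i x) (vf_comp Y i) x - 'D_(vf_comp Y i x) (vf_comp X i) x.

Fact lie_bracket_smooth X Y i : smooth_on (img i) (lie_bracket_comp X Y i).
Proof.
have oi := @img_open i.
have sD Z Z' : smooth_on (img i)
    (fun x => 'D_(vf_comp Z i x) (vf_comp Z' i) x).
  apply/smooth_mxP => // k l n.
  have H : diff_upto n (img i) (fun x => \sum_h
      vf_comp Z i x 0 h * 'D_(delta_mx 0 h) (vf_comp Z' i) x k l).
    apply: diff_upto_sum => // h; apply: diff_uptoM => //.
      by have /(smooth_mxP _ oi)/(_ 0 h) := vf_smooth Z i; apply.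
    have /(smooth_mxP _ oi)/(_ k l) :=
      derive_smooth (delta_mx 0 h) (vf_smooth Z' i).
    exact.
  apply: diff_upto_eq H => // x ix; rewrite derive_rV ?summxE; last first.
    exact: smooth_diff (vf_smooth Z' i) ix.
  by apply: eq_bigr => h _; rewrite mxE.
exact: smoothB oi (sD X Y) (sD Y X).
Qed.

Fact lie_bracket_change X Y i j x : ovl i j x ->
  lie_bracket_comp X Y j (tau i j x) =
    lie_bracket_comp X Y i x *m 'J (tau i j) x.
Proof.
move=> Oij; have dt := tau_diff Oij.
have oO : open (ovl i j) by exact: overlap_open.
set J := 'J _ _.
pose S (v w : 'rV[R]_m) : 'rV[R]_m := \row_l \sum_k \sum_h
  v 0 h * w 0 k * 'D_(delta_mx 0 h) (fun y =>
    'D_(delta_mx 0 k) (tau i j) y) x 0 l.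
have SC v w : S v w = S w v.
  rewrite /S; apply/rowP => l; rewrite !mxE exchange_big; apply: eq_bigr => k _.
  apply: eq_bigr => h _; rewrite [v _ _ * _]mulrC; apply: (congr1 (fun z => _ * z)).
  exact: (derive2C (delta_mx 0 k) (delta_mx 0 h) 0 l oO (atlas_smooth i j) Oij).
have D Z Z' : 'D_(vf_comp Z j (tau i j x)) (vf_comp Z' j) (tau i j x) =
    'D_(vf_comp Z i x) (vf_comp Z' i) x *m J + S (vf_comp Z i x) (vf_comp Z' i x).
  have dZ' := smooth_diff (vf_smooth Z' j) (ovl_tau Oij).
  have dZ'i : differentiable (vf_comp Z' i) x.
    by apply: smooth_diff (vf_smooth Z' i) _; case: Oij.
  have dDt k : differentiable (fun y => 'D_(delta_mx 0 k) (tau i j) y) x.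
    exact: smooth_diff (derive_smooth _ (atlas_smooth _ _)) Oij.
  rewrite (vf_change Z Oij) -deriveEjacobian// -(derive_chain _ dt dZ').
  apply/rowP => l; rewrite !mxE -derive_coord; last first.
    exact: (@differentiable_comp _ _ _ _ (tau i j)).
  rewrite (@near_eq_derive _ _ _ _ (\sum_k (fun y =>
      vf_comp Z' i y 0 k * 'D_(delta_mx 0 k) (tau i j) y 0 l))); last first.
    apply: (tau_near Oij) => y Oy; rewrite (vf_change Z' Oy) mxE fct_sumE.
    by apply: eq_bigr => p _; rewrite J_entry//; exact: tau_diff.
  have dDtk k := (differentiable_mxP _ _).2 (dDt k) 0 l.
  have dZk k := (differentiable_mxP _ _).2 dZ'i 0 k.
  rewrite derive_sum => [|k]; last first.
    by apply: diff_derivable; exact: differentiableM.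
  rewrite -big_split; apply: eq_bigr => k _ /=.
  rewrite deriveM; [|exact: diff_derivable..].
  rewrite [RHS]addrC; congr (_ + _); last first.
    by rewrite derive_coord// J_entry//; exact: mulrC.
  rewrite derive_coord// (derive_rV _ (dDt k)) summxE.
  apply: etrans (mulr_sumr _ _ _ _) _.
  by apply: eq_bigr => h _; rewrite mxE mulrA (mulrC (vf_comp Z' i x 0 k)).
rewrite /lie_bracket_comp (D X Y) (D Y X) (SC (vf_comp X i x)).
by rewrite opprD addrACA subrr addr0 mulmxBl.
Qed.

Definition lie_bracket X Y : vector_field :=
  VectorField (lie_bracket_smooth X Y) (@lie_bracket_change X Y).

Definition vf_apply (X : vector_field) (h : smooth_fun) : smooth_fun :=
  pairing (differential h) X.

(* Equality of 1-forms is equality of components at the points of the charts. *)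
Definition is_reeb (alpha : one_form) (Rb : vector_field) : Prop :=
  (forall p, pairing alpha Rb p = 1) /\
  (forall i x, img i x -> of_comp (contraction Rb (ext_deriv alpha)) i x = 0).

(* Rb stands for the Reeb vector field of alpha. *)
Definition is_contact_hamiltonian (alpha : one_form) (Rb : vector_field)
    (H : smooth_fun) (X : vector_field) : Prop :=
  (forall p, pairing alpha X p = H p) /\
  (forall i x, img i x ->
    of_comp (contraction X (ext_deriv alpha)) i x =
      pairing (differential H) Rb (bwd i x) *: of_comp alpha i x
      - of_comp (differential H) i x).

(* The bracket [f, g], where Xf and Xg are the contact Hamiltonian vector
   fields of f and g. *)
Definition jacobi_bracket (alpha : one_form) (Xf Xg : vector_field) :
  smooth_fun := pairing alpha (lie_bracket Xf Xg).

End Fields.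

Section Wedge.
Context {R : realType} {m : nat}.

(* k-covectors on R^m, as functions of k vectors *)
Definition covector (k : nat) := ('I_k -> 'rV[R]_m) -> R.

Definition wedge (k l : nat) (a : covector k) (b : covector l) :
  covector (k + l) := fun v =>
  (k`!%:R * l`!%:R)^-1 * \sum_(s : 'S_(k + l)) (-1) ^+ s *
    a (fun i => v (s (lshift l i))) * b (fun j => v (s (rshift k j))).

Fixpoint wedge_pow (w : covector 2) (n : nat) : covector (n * 2) :=
  if n is n'.+1 then wedge w (@wedge_pow w n') else fun=> 1.

Definition covector1 (a : 'cV[R]_m) : covector 1 :=
  fun v => (v 0 *m a) 0 0.

Definition covector2 (w : 'M[R]_m) : covector 2 :=
  fun v => (v 0 *m w *m (v 1)^T) 0 0.

End Wedge.
Arguments wedge_pow {R m} w n _.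

Definition is_contact_form (R : realType) (n : nat)
    (M : smooth_manifold R (2 * n).+1) (alpha : one_form M) : Prop :=
  forall i x, chart_img (atlas i) x -> exists v,
    wedge (covector1 (of_comp alpha i x))
      (wedge_pow (covector2 (tf_comp (ext_deriv alpha) i x)) n) v != 0.

(* Main.v *)
From mathcomp Require Import normedtype derive lra.
Require Import Defs.
From mathcomp Require Import all_boot all_order all_algebra.
From mathcomp Require Import all_classical reals topology.

Import GRing.Theory numFieldNormedType.Exports.
Local Open Scope ring_scope.

(** Cartan's formula
      d alpha (X, Y) = X (alpha Y) - Y (alpha X) - alpha [X, Y]
    gives the result by substitution. With X = X_f and Y = X_g, the functions
    alpha Y and alpha X are g and f, so that
      [f, g] = X_f (g) - X_g (f) - d alpha (X_f, X_g);
    pairing the equation i_{X_f} d alpha = R (f) alpha - df with X_g gives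
    d alpha (X_f, X_g) = g R (f) - X_g (f), and the two terms X_g (f) cancel.

    Cartan's formula itself (ext_deriv_cartan) is checked in a chart. There
    X (alpha Y) = alpha (D_X Y) + (D_X alpha) (Y) by the product rule
    (derive_mulmx); subtracting the same identity with X and Y exchanged, the
    derivatives of the vector fields assemble into alpha [X, Y] and those of
    the form into d alpha (X, Y) (ext_deriv_pairing). *)

Section Cartan.
Context {R : realType}.

Lemma derive_mulmx (V : normedModType R) a b c (F : V -> 'M[R]_(a, b))
    (G : V -> 'M[R]_(b, c)) x v i j :
  differentiable F x -> differentiable G x ->
  'D_v (fun y => (F y *m G y) i j) x =
    ('D_v F x *m G x) i j + (F x *m 'D_v G x) i j.
Proof.
move=> dF dG.
have dFk k := (differentiable_mxP _ _).2 dF i k.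
have dGk k := (differentiable_mxP _ _).2 dG k j.
have -> : (fun y => (F y *m G y) i j) = \sum_k (fun y => F y i k * G y k j).
  by apply/funext => y; rewrite mxE fct_sumE.
rewrite derive_sum => [|k]; last first.
  by apply: diff_derivable; exact: differentiableM.
rewrite !mxE -big_split; apply: eq_bigr => k _ /=.
rewrite deriveM; [|exact: diff_derivable..].
rewrite !derive_coord// [RHS]addrC; congr (_ + _); exact: mulrC.
Qed.

Context {m : nat} {M : smooth_manifold R m}.
Implicit Types (alpha : one_form M) (X Y : vector_field M) (h : smooth_fun M).
Local Notation img i := (chart_img (atlas (s := M) i)).
Local Notation bwd i := (chart_bwd (atlas (s := M) i)).

Lemma chart_ind (P : M -> Prop) :
  (forall i x, img i x -> P (bwd i x)) -> forall p, P p.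
Proof.
move=> IH p; have [i ip] := atlas_cover p.
by rewrite -(chart_fwdK ip); apply: IH; exact: chart_fwd_img.
Qed.

Lemma vf_apply_chart X h i x : img i x ->
  vf_apply X h (bwd i x) = 'D_(vf_comp X i x) (fun y => h (bwd i y)) x.
Proof.
move=> ix; have dh := smooth_diff (sf_smooth h i) ix.
rewrite (derive_rV _ dh); apply: etrans (pairing_chart _ _ ix) _.
by rewrite mxE; apply: eq_bigr => k _; rewrite mxE.
Qed.

(** Lets alpha (X_f) be replaced by f under a vector field: the two smooth
    functions have the same values, but are given with different proofs of
    smoothness. *)
Lemma vf_apply_ext X h h' : h =1 h' -> vf_apply X h =1 vf_apply X h'.
Proof.
move=> hh'; apply: chart_ind => i x ix; rewrite !vf_apply_chart//.
by congr ('D_ _ _ _); apply/funext => y; exact: hh'.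
Qed.

Lemma vf_apply_pairing alpha X Y i x : img i x ->
  vf_apply X (pairing alpha Y) (bwd i x) =
    ('D_(vf_comp X i x) (vf_comp Y i) x *m of_comp alpha i x) 0 0 +
    (vf_comp Y i x *m 'D_(vf_comp X i x) (of_comp alpha i) x) 0 0.
Proof.
move=> ix; rewrite vf_apply_chart//.
rewrite -derive_mulmx; last 2 first.
- exact: smooth_diff (vf_smooth Y i) ix.
- exact: smooth_diff (of_smooth alpha i) ix.
apply: near_eq_derive; apply: (open_near_eq (@img_open _ _ _ i) ix) => y iy.
exact: pairing_chart.
Qed.

(** In components d alpha = A - A^T, where A k l is the derivative of the l-th
    component of alpha along the k-th coordinate vector; the row X A lists the
    components of the derivative of alpha along X. *)
Lemma ext_deriv_pairing alpha X Y i x : img i x ->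
  pairing (contraction X (ext_deriv alpha)) Y (bwd i x) =
    (vf_comp Y i x *m 'D_(vf_comp X i x) (of_comp alpha i) x) 0 0 -
    (vf_comp X i x *m 'D_(vf_comp Y i x) (of_comp alpha i) x) 0 0.
Proof.
move=> ix; have da := smooth_diff (of_smooth alpha i) ix.
pose A : 'M[R]_m := \matrix_(k, l) 'D_(delta_mx 0 k) (of_comp alpha i) x l 0.
have DA v : 'D_v (of_comp alpha i) x = (v *m A)^T.
  apply/colP => l; rewrite (derive_rV _ da) summxE !mxE.
  by apply: eq_bigr => k _; rewrite !mxE.
have dalpha : ext_deriv_comp alpha i x = A - A^T.
  by apply/matrixP => k l; rewrite !mxE.
rewrite [LHS](pairing_chart _ _ ix) /= /contraction_comp /= dalpha !DA.
rewrite mulmxBr linearB /= mulmxBr [LHS]mxE [X in _ + X]mxE.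
congr (_ - _).
have tr11 (B : 'M[R]_1) : B 0 0 = B^T 0 0 by rewrite mxE.
by rewrite [LHS]tr11 trmx_mul trmxK trmx_mul mulmxA.
Qed.

Lemma ext_deriv_cartan alpha X Y p :
  pairing (contraction X (ext_deriv alpha)) Y p =
    vf_apply X (pairing alpha Y) p - vf_apply Y (pairing alpha X) p
    - pairing alpha (lie_bracket X Y) p.
Proof.
move: p; apply: chart_ind => i x ix.
rewrite ext_deriv_pairing// !vf_apply_pairing//.
rewrite [pairing alpha _ _](pairing_chart _ _ ix) /= /lie_bracket_comp.
rewrite mulmxBl [X in _ = _ - X]mxE [X in _ = _ - (_ + X)]mxE.
lra.
Qed.

Lemma contact_hamiltonian_pairing alpha Rb h X Y p :
  is_contact_hamiltonian alpha Rb h X ->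
  pairing (contraction X (ext_deriv alpha)) Y p =
    vf_apply Rb h p * pairing alpha Y p - vf_apply Y h p.
Proof.
move=> [_ Xh]; move: p; apply: chart_ind => i x ix.
rewrite [LHS](pairing_chart _ _ ix) Xh// mulmxBr -scalemxAr.
rewrite [pairing alpha _ _](pairing_chart _ _ ix).
rewrite [vf_apply Y _ _](pairing_chart _ _ ix).
by rewrite [LHS]mxE [X in X + _]mxE [X in _ + X]mxE.
Qed.

End Cartan.

Theorem proposition3p1p11 (R : realType) (n : nat)
    (M : smooth_manifold R (2 * n).+1) (alpha : one_form M)
    (alpha_contact : is_contact_form alpha)
    (Rb : vector_field M) (Rb_reeb : is_reeb alpha Rb)
    (f g : smooth_fun M) (Xf Xg : vector_field M)
    (Xf_ham : is_contact_hamiltonian alpha Rb f Xf)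
    (Xg_ham : is_contact_hamiltonian alpha Rb g Xg) :
  forall p : M,
    jacobi_bracket alpha Xf Xg p = vf_apply Xf g p - g p * vf_apply Rb f p.
Proof.
move=> p; have [[alphaXf _] [alphaXg _]] := (Xf_ham, Xg_ham).
have := ext_deriv_cartan alpha Xf Xg p.
rewrite (contact_hamiltonian_pairing alpha Rb f Xf Xg p Xf_ham) alphaXg.
rewrite (vf_apply_ext Xf _ g alphaXg) (vf_apply_ext Xg _ f alphaXf).
rewrite /jacobi_bracket => E.
lra.
Qed.
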